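(* Let $\mathcal X,\mathcal Y\subset\mathbb R^d$ be endowed with probability measures $P$ and $Q$. Suppose: 1. $P$ and $Q$ have finite second moments, and $P$ is absolutely continuous with respect to Lebesgue measure. 2. The matrix $A_0\in\mathbb R^{d\times d}$ in the surplus function $s(x,y)=x'A_0y+x'b_0$ is invertible. 3. There exist $y_1,\ldots,y_{d+1}\in\mathcal Y$ such that $\{y_1-y_2,\,y_2-y_3,\ldots,y_d-y_{d+1}\}$ is linearly independent. Suppose that the observation $z_i=(w_i,x_i',y_i')'$ satisfies the conditional moment restrictions $\mathbb E[\rho(z_i;\theta_0,w_0)\mid x_i]=0$ at the true parameter value $(\theta_0,w_0)$, where $\theta_0=(\mathrm{vec}(A_0^{-1})',b_0')'$ and $w_0=w_0^{o*}+c_0$. Then $\theta_0$ and $w_0$ are identified.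
   Context: Matching model: workers $x\in\mathcal X$ have law $P$, and jobs $y\in\mathcal Y$ have law $Q$, with $\mathcal Y$ taken to be the support of $Q$. The surplus is $s(x,y)=x'A_0y+x'b_0$. The equilibrium of the associated optimal transport (transferable utility matching) problem is described by a convex function $w_0^{o*}$ solving the dual problem $\inf_{w}\{\mathbb E_P[w(X)]+\mathbb E_Q[\sup_{x\in\mathcal X}\{x'A_0Y-w(x)\}]\}$. The equilibrium wage is $w_0^*(x)=w_0^{o*}(x)+x'b_0+c_0$ for a constant $c_0$. The equilibrium assignment is $y^*(x)=A_0^{-1}\nabla w_0^{o*}(x)$, which pushes $P$ forward to $Q$. Econometric model: $x_i\sim P$, and $$w_i=w_0^{o*}(x_i)+x_i'b_0+c_0+\varepsilon_{wi},\qquad y_i=A_0^{-1}\nabla w_0^{o*}(x_i)+\varepsilon_{yi},$$ where $\varepsilon_{wi}\in\mathbb R$ and $\varepsilon_{yi}\in\mathbb R^d$ are measurement errors. For $\theta=(\mathrm{vec}(A^{-1})',b')'\in\Theta$, where $\Theta\subset\mathbb R^{d^2+d}$ is compact, and a convex function $w$, define $$\rho(z_i;\theta,w)=\begin{pmatrix} w_i-(w(x_i)+x_i'b)\\ y_i-A^{-1}\nabla w(x_i)\end{pmatrix}.$$ Thus the moment restrictions at the truth say $\mathbb E[\varepsilon_{wi}\mid x_i]=0$ and $\mathbb E[\varepsilon_{yi}\mid x_i]=0$. ''Identified'' means uniquely determined by the joint distribution of $(w_i,x_i,y_i)$: if $(\theta,w)$, with $\theta=(\mathrm{vec}(A^{-1})',b')'\in\Theta$,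 $A$ invertible and $w$ convex (finite $P$-a.e.), also satisfies $\mathbb E[\rho(z_i;\theta,w)\mid x_i]=0$ almost surely under this distribution, then $\theta=\theta_0$ and $w=w_0$ $P$-almost everywhere. Gradients of convex functions are understood $P$-almost everywhere. *)

(* Defs.v *)
From HB Require Import structures.
From mathcomp Require Import all_boot all_order all_algebra.
From mathcomp Require Import all_classical all_reals all_analysis.

Set Implicit Arguments.
Unset Strict Implicit.
Unset Printing Implicit Defensive.

Import Order.TTheory GRing.Theory Num.Theory.
Import numFieldNormedType.Exports.

Local Open Scope classical_set_scope.
Local Open Scope ring_scope.

HB.instance Definition _ (R : realType) (m n : nat) :=
  @isMeasurable.Build (sigma_display (@open 'M[R]_(m, n))) 'M[R]_(m, n)
    <<s @open 'M[R]_(m, n) >>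
    (@sigma_algebra0 _ setT open) (@sigma_algebraC _ open)
    (@sigma_algebra_bigcup _ setT open).

Section euclidean.
Variable R : realType.

(* The d-fold product of the one-dimensional Lebesgue measure, on Borel sets
   of R^d (the one-point space R^0 gets mass 1). *)
Fixpoint lebesgue_Rd (d : nat) : set 'cV[R]_d -> \bar R :=
  match d with
  | 0 => fun A => \d_(0 : 'cV[R]_0) A
  | d'.+1 => fun A : set 'cV[R]_(1 + d') =>
      ((@lebesgue_measure R) \x (@lebesgue_Rd d'))%E
        [set p | A (col_mx p.1%:M p.2)]
  end.

Variable d : nat.
Implicit Types (P Q : probability 'cV[R]_d R) (w : 'cV[R]_d -> \bar R).

Definition dot (x y : 'cV[R]_d) : R := (x^T *m y) 0 0.

Definition finite_second_moment P := (\int[P]_x (dot x x)%:E < +oo)%E.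

Definition msupport P : set 'cV[R]_d :=
  [set y | forall U : set 'cV[R]_d, open U -> U y -> (0 < P U)%E].

Definition econvex w :=
  (forall x, w x != -oo%E) /\
  forall (x y : 'cV[R]_d) (t : R), 0 <= t <= 1 ->
    (w (t *: x + (1 - t) *: y)%R <= t%:E * w x + (1 - t)%R%:E * w y)%E.

(* Column of partial derivatives.  For w convex and P-a.e. finite, with P
   absolutely continuous, w is finite near x and differentiable at x for P-a.e.
   x; at the other points the value is an irrelevant default. *)
Definition gradient w (x : 'cV[R]_d) : 'cV[R]_d :=
  \col_i 'D_(delta_mx i 0) (fun u => fine (w u) : R^o) x.

End euclidean.

Section almost_everywhere_versions.
Context {d1 d2 : measure_display} {T : measurableType d1}
  {T' : measurableType d2} {R : realType}.
Variable mu : {measure set T -> \bar R}.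

(* A convex function and its gradient need not be Borel on the boundary of the
   domain, so integrability, push-forward and conditional expectation are
   required of functions that are only a.e. equal to a measurable one. *)
Definition ae_integrable (f : T -> \bar R) :=
  exists2 g, mu.-integrable setT g & {ae mu, forall x, f x = g x}.

Definition pushes_forward (f : T -> T') (nu : set T' -> \bar R) :=
  exists g : T -> T', [/\ measurable_fun setT g,
    {ae mu, forall x, f x = g x} &
    forall B, measurable B -> mu (g @^-1` B) = nu B].

(* E[Z | X] = g(X) almost surely *)
Definition is_cond_expectation (Z : T -> R) (X : T -> T') (g : T' -> R) :=
  [/\ ae_integrable (EFin \o Z),
      measurable_fun setT g,
      mu.-integrable setT (fun z => (g (X z))%:E) &
      forall B, measurable B ->
        (\int[mu]_(z in X @^-1` B) (Z z)%:E =
         \int[mu]_(z in X @^-1` B) (g (X z))%:E)%E].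

End almost_everywhere_versions.

(* observations z = (wage, x, y) *)
Notation obs R d := (R * 'cV[R]_d * 'cV[R]_d)%type.

Section matching.
Variables (R : realType) (d : nat).
Implicit Types (P Q : probability 'cV[R]_d R) (X Y : set 'cV[R]_d).
Implicit Types (A : 'M[R]_d) (b : 'cV[R]_d) (w : 'cV[R]_d -> \bar R).

Definition dual_objective P Q X A w : \bar R :=
  (\int[P]_x w x +
   \int[Q]_y ereal_sup [set (dot x (A *m y))%:E - w x | x in X])%E.

(* For P-integrable w the first term is finite and, when Q has a finite second
   moment, the second is well defined in ]-oo, +oo]. *)
Definition dual_solution P Q X A w :=
  ae_integrable P w /\
  forall v, ae_integrable P v ->
    (dual_objective P Q X A w <= dual_objective P Q X A v)%E.

Definition assignment A w (x : 'cV[R]_d) : 'cV[R]_d :=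
  invmx A *m gradient w x.

(* vec stacks columns, whereas mxvec concatenates rows. *)
Definition theta_of A b : 'cV[R]_(d * d + d) :=
  col_mx (mxvec (invmx A)^T)^T b.

Definition theta_invA (theta : 'cV[R]_(d * d + d)) : 'M[R]_d :=
  (vec_mx (usubmx theta)^T)^T.

Definition theta_b (theta : 'cV[R]_(d * d + d)) : 'cV[R]_d := dsubmx theta.

Definition obs_x (z : obs R d) : 'cV[R]_d := z.1.2.

Definition rho (theta : 'cV[R]_(d * d + d)) w (z : obs R d) : 'cV[R]_(1 + d) :=
  let: (wage, x, y) := z in
  col_mx (wage - (fine (w x) + dot x (theta_b theta)))%:M
         (y - theta_invA theta *m gradient w x).

Definition moment_restriction (mu : probability (obs R d) R) theta w :=
  forall i : 'I_(1 + d),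
    is_cond_expectation mu (fun z => rho theta w z i 0) obs_x (cst 0).

Definition identified (mu : probability (obs R d) R) P
    (Theta : set 'cV[R]_(d * d + d)) theta0 w0 :=
  forall A b w, A \in unitmx -> Theta (theta_of A b) ->
    econvex w -> {ae P, forall x, w x \is a fin_num} ->
    moment_restriction mu (theta_of A b) w ->
    theta_of A b = theta0 /\ {ae P, forall x, w x = w0 x}.

End matching.

(* Main.v *)
(* Two conditional expectations given [x] that differ by a function of [x] force
   that function to vanish P-a.e.  Applied to both components of the moment
   restrictions this yields [w x = w0 x + x'(b0 - b)] and
   [A^-1 grad w = A0^-1 grad w0] P-a.e.

   The first equality can be differentiated although it only holds P-a.e.: on
   almost every line parallel to an axis, a point of a measurable set is a limit
   of other points of that set at rational distance, and a convex function has
   at most one point where its subdifferential contains a given interval.  Both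
   facts reduce to: a Borel set whose small positive rational translates in a
   coordinate direction never return to it is Lebesgue null.

   Hence [grad w = grad w0 + (b0 - b)], so [y = A0^-1 grad w0] satisfies
   [A^-1 (A0 y + b0 - b) = y] Q-a.e., hence on the support of Q.  As the support
   contains d+1 affinely independent points, [A^-1 A0 = 1] and [b = b0]. *)

From HB Require Import structures.
Require Import Defs.
From mathcomp Require Import all_boot all_order all_algebra.
From mathcomp Require Import all_classical all_reals all_analysis.
From mathcomp Require Import measurable_realfun ring lra.

Set Implicit Arguments.
Unset Strict Implicit.
Unset Printing Implicit Defensive.

Import Order.TTheory GRing.Theory Num.Theory.
Import numFieldNormedType.Exports.

Local Open Scope classical_set_scope.
Local Open Scope ring_scope.

(** * Borel measurability on spaces of matrices *)

Section borel_matrices.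
Context {R : realType} (m n : nat).

Lemma open_measurable_mx (U : set 'M[R]_(m, n)) : open U -> measurable U.
Proof. by move=> oU; apply: sub_sigma_algebra. Qed.

Lemma closed_measurable_mx (U : set 'M[R]_(m, n)) : closed U -> measurable U.
Proof.
by move=> cU; rewrite -[U]setCK; apply: measurableC; apply: open_measurable_mx;
  rewrite openC.
Qed.

Lemma measurable_mx_coord i j :
  measurable_fun setT (fun M : 'M[R]_(m, n) => M i j).
Proof.
apply: (measurability _ (RGenOpens.measurableE R)) => _ [_ [x [y ->] <-]].
rewrite setTI; apply: open_measurable_mx; apply: open_comp; last exact: interval_open.
by move=> M _; exact: coord_continuous.
Qed.

Lemma mx_rational_approx (x : 'M[R]_(m, n)) (e : R) : 0 < e ->
  exists c : 'M[rat]_(m, n), forall i j, `|x i j - ratr (c i j)| < e.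
Proof.
move=> e0.
have H (i : 'I_m) (j : 'I_n) : exists q : rat, `|x i j - ratr q| < e.
  have /rat_in_itvoo[q] : x i j - e < x i j + e by lra.
  rewrite in_itv/= => /andP[h1 h2]; exists q; rewrite ltr_norml; lra.
exists (\matrix_(i, j) sval (cid (H i j))) => i j; rewrite mxE.
by case: cid.
Qed.

(** An open set is a countable union of boxes with rational centres and radii $1/(k+1)$. The
    preimage of a box is a finite intersection of conditions on single entries. *)
Lemma measurable_fun_mxP d (T : measurableType d) (f : T -> 'M[R]_(m, n)) :
  (forall i j, measurable_fun setT (fun t => f t i j)) -> measurable_fun setT f.
Proof.
move=> mf; apply: (@measurability _ _ _ _ _ f open) => // _ [U oU <-].
rewrite setTI.
pose box (p : 'M[rat]_(m, n) * nat) :=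
  [set x : 'M[R]_(m, n) | forall i j, `|x i j - ratr (p.1 i j)| < p.2.+1%:R^-1].
have -> : U = \bigcup_(p in [set p | box p `<=` U]) box p.
  apply/seteqP; split=> [x Ux|x [p/= pU /pU]//].
  have /nbhs_ballP[e/= e0 eU] : nbhs x U by exact: open_nbhs_nbhs.
  have [k ke] : exists k : nat, k.+1%:R^-1 < e / 2.
    have /ltr_add_invr[k] : 0 < e / 2 by rewrite divr_gt0.
    by rewrite add0r; exists k.
  have [c xc] : exists c : 'M[rat]_(m, n), forall i j,
      `|x i j - ratr (c i j)| < k.+1%:R^-1.
    by apply: mx_rational_approx; rewrite invr_gt0.
  exists (c, k) => //= y /= yc; apply: eU.
  rewrite mx_norm_ball /ball_ /= [`|_|]mx_normrE.
  apply/bigmax_ltP; split=> // -[i j] _ /=; rewrite !mxE.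
  have := xc i j; have := yc i j => h1 h2.
  have -> : x i j - y i j = (x i j - ratr (c i j)) - (y i j - ratr (c i j)) by lra.
  apply: le_lt_trans (ler_normB _ _) _; rewrite [e]splitr.
  exact: ltrD (lt_trans h2 ke) (lt_trans h1 ke).
rewrite preimage_bigcup bigcup_mkcond; apply: countable_bigcupT_measurable.
  exact: countableP.
move=> p; case: ifP => // _.
have -> : f @^-1` (box p) = \bigcap_(i in [set: 'I_m])
    \bigcap_(j in [set: 'I_n]) [set t | `|f t i j - ratr (p.1 i j)| < p.2.+1%:R^-1].
  by apply/seteqP; split=> [t + i _ j _|t + i j]; [exact|exact].
apply: fin_bigcap_measurable => // i _; apply: fin_bigcap_measurable => // j _.
rewrite -[X in measurable X]setTI.
apply: measurable_fun_ltr => //; apply: measurableT_comp => //.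
exact: measurable_funB.
Qed.

End borel_matrices.

(** * Regularity of probabilities on the space of observations *)

Section inner_regularity.
Context {R : realType}.

Lemma nonincreasing_measure_lt d (T : measurableType d)
    (mu : probability T R) (F : (set T)^nat) (e : \bar R) :
  (forall i, measurable (F i)) -> nonincreasing_seq F ->
  (mu (\bigcap_n F n) < e)%E -> exists n, (mu (F n) < e)%E.
Proof.
move=> mF niF Fe; apply: contrapT => /forallNP H.
have cv : mu \o F @ \oo --> mu (\bigcap_n F n).
  apply: nonincreasing_cvg_mu => //; last exact: bigcapT_measurable.
  by rewrite (le_lt_trans (probability_le1 _ _))// ltry.
move: Fe; rewrite ltNge => /negP; apply.
rewrite -(cvg_lim _ cv)//; apply: lime_ge; first by apply/cvg_ex; eexists; exact: cv.
by near=> n; rewrite leNgt; apply/negP; exact: H.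
Unshelve. all: by end_near. Qed.

Section approximation.
Context d (T : measurableType d) (mu : probability T R) (Kc : set (set T)).
Hypothesis Kc_meas : Kc `<=` measurable.
Hypothesis Kc0 : Kc set0.
Hypothesis KcU : setU_closed Kc.
Hypothesis KcI : forall F : (set T)^nat, (forall n, Kc (F n)) -> Kc (\bigcap_n F n).

(** Inner approximation by [Kc] is asked of [A] and of its complement at once. This makes the notion
    symmetric under complementation, so that approximable sets can form a sigma-algebra. *)
Definition approximable (A : set T) := forall e : R, 0 < e ->
  exists F G, [/\ Kc F, Kc G, F `<=` A, G `<=` ~` A & (mu (~` (F `|` G)) < e%:E)%E].

Lemma approximableC A : approximable A -> approximable (~` A).
Proof.
move=> aA e /aA[F [G [KF KG FA GA muFG]]]; exists G, F; split => //.
  by rewrite setCK.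
by rewrite setUC.
Qed.

(** [Kc] is stable under finite unions and countable intersections. The complement is therefore
    approximated by the whole intersection [G], but the union only by finite unions [Fk k];
    continuity from above then supplies a sufficient [k]. *)
Lemma approximable_bigcup (A : (set T)^nat) :
  (forall n, approximable (A n)) -> approximable (\bigcup_n A n).
Proof.
move=> aA e e0.
have e20 : 0 < e / 2 by rewrite divr_gt0.
have en0 n : 0 < e / 2 / (2 ^ n.+1)%:R by rewrite divr_gt0// ltr0n expn_gt0.
have /choice[FG FGP] n := aA n _ (en0 n).
have {FGP}/choice[F FP] : forall n, exists p : set T * set T,
    [/\ Kc p.1, Kc p.2, p.1 `<=` A n, p.2 `<=` ~` A n &
      (mu (~` (p.1 `|` p.2)) < (e / 2 / (2 ^ n.+1)%:R)%:E)%E].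
  by move=> n; have [G GP] := FGP n; exists (FG n, G).
pose G := \bigcap_n (F n).2.
pose Fk k := \bigcup_(n < k) (F n).1.
have KG : Kc G by apply: KcI => n; have [] := FP n.
have KFk k : Kc (Fk k).
  rewrite /Fk (bigcup_mkord k (fun n => (F n).1)).
  by apply: (big_ind Kc) => // i _; have [] := FP i.
have mF n : measurable (F n).1 by apply: Kc_meas; have [] := FP n.
have mF2 n : measurable (F n).2 by apply: Kc_meas; have [] := FP n.
have mFG n : measurable (~` ((F n).1 `|` (F n).2)).
  by apply: measurableC; exact: measurableU.
have mGk k : measurable (~` (Fk k `|` G)).
  by apply: measurableC; apply: measurableU; apply: Kc_meas.
have [] := @nonincreasing_measure_lt _ _ mu (fun k => ~` (Fk k `|` G)) e%:E mGk.
- move=> i j ij; apply/subsetPset; apply: subsetC; apply: setSU.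
  move=> x [l /= li Fl]; exists l => //=.
  exact: leq_trans ij.
(* The errors $e/2^{n+2}$ add up to $e/2$, which keeps the final inequality strict. A point outside
   [G] and every [Fk k] is missed by the pair [F n] for some [n]. *)
- apply: (@le_lt_trans _ _ (e / 2)%:E); last by rewrite lte_fin ltr_pdivrMr// ltr_pMr// ltr1n.
  apply: le_trans (epsilon_trick0 xpredT (ltW e20)).
  apply: le_trans; last first.
    apply: lee_nneseries => [n *|n *]; last by apply/ltW; have [_ _ _ _] := FP n; apply.
    exact: (measure_ge0 mu).
  apply: measure_sigma_subadditive => //; first exact: bigcapT_measurable.
  move=> x /= H; apply: contrapT => H2.
  have {}H2 n : ((F n).1 `|` (F n).2) x.
    by apply: contrapT => H3; apply: H2; exists n.
  case: (pselect (exists n, (F n).1 x)) => [[n Fnx]|nF].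
    apply: (H n.+1 I); left; exists n => //=.
  apply: (H 0%N I); right => n _; have [|//] := H2 n.
  by move=> Fn; exfalso; apply: nF; exists n.
- move=> k muk; exists (Fk k), G; split => //.
    move=> x [n _ Fx]; exists n => //.
    by have [_ _ + _ _] := FP n; apply.
  move=> x Gx [n _ Ax]; have [_ _ _ + _] := FP n; move=> /(_ x); apply => //.
  exact: Gx.
Qed.

(** The approximating pairs are the preimages of [C n] and of the complement of [U], cut down to
    [K n]. As [K n] exhausts the space and [C n] exhausts [U], the points left out decrease to the
    empty set. *)
Lemma approximable_preimage (K : (set T)^nat) (S : topologicalType)
    (f : T -> S) (C : (set S)^nat) (U : set S) :
  (forall n, Kc (K n)) -> nondecreasing_seq K -> \bigcup_n K n = setT ->
  (forall D, closed D -> forall n, Kc (K n `&` f @^-1` D)) ->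
  open U -> (forall n, closed (C n)) -> nondecreasing_seq C -> U = \bigcup_n C n ->
  approximable (f @^-1` U).
Proof.
move=> KK ndK KT KD oU cC ndC UC e e0.
have cUC : closed (~` U) by rewrite closedC.
have mKU n : measurable (~` (K n `&` f @^-1` C n `|` K n `&` f @^-1` (~` U))).
  by apply: measurableC; apply: measurableU; apply: Kc_meas; apply: KD.
have [] := @nonincreasing_measure_lt _ _ mu _ e%:E mKU.
- move=> i j ij; apply/subsetPset; apply: subsetC; apply: setUSS; apply: setISS => //.
  + exact/subsetPset/ndK.
  + by apply: preimage_subset; exact/subsetPset/ndC.
  + exact/subsetPset/ndK.
- rewrite [X in mu X](_ : _ = set0) ?measure0 ?lte_fin//.
  apply/seteqP; split=> [x /= H|//].
  have [i _ Kx] : (\bigcup_n K n) x by rewrite KT.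
  have Kj j : (i <= j)%N -> K j x by move=> /ndK/subsetPset; exact.
  have [Ux|nUx] := pselect (U (f x)).
    have : (\bigcup_n C n) (f x) by rewrite -UC.
    move=> [j _ Cj]; apply: (H (maxn i j) I); left; split.
      exact/Kj/leq_maxl.
    by have /subsetPset := ndC _ _ (leq_maxr i j); apply.
  by apply: (H i I); right.
- move=> n mun; exists (K n `&` f @^-1` C n), (K n `&` f @^-1` (~` U)); split => //.
  + exact: KD.
  + exact: KD.
  + by move=> x [_ /= Cx]; rewrite /= UC; exists n.
Qed.

End approximation.

(** [C n] consists of the points whose ball of radius $1/(n+1)$ lies in [U]. Its complement is a
    union of balls, hence open. *)
Lemma open_bigcup_closed (V : normedModType R) (U : set V) : open U ->
  exists C : (set V)^nat, [/\ forall n, closed (C n), nondecreasing_seq C &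
    U = \bigcup_n C n].
Proof.
move=> oU; exists (fun n => [set x | ball x n.+1%:R^-1 `<=` U]); split.
- move=> n; rewrite -[X in closed X]setCK closedC.
  have -> : ~` [set x | ball x n.+1%:R^-1 `<=` U] =
      \bigcup_(y in ~` U) ball y n.+1%:R^-1.
    apply/seteqP; split=> [x /=|x [y Uy xy] /= /(_ y)].
      by rewrite -existsNP => -[y /not_implyP[xy Uy]]; exists y => //; exact: ball_sym.
    by move=> H; apply: Uy; apply: H; exact: ball_sym.
  by apply: bigcup_open => y _; exact: ball_open.
- move=> i j ij; apply/subsetPset => x /= xU; apply: subset_trans xU.
  by apply: le_ball; rewrite lef_pV2 ?posrE// ler_nat.
- apply/seteqP; split=> [x Ux|x [n _ /=]]; last first.
    by apply; exact: ballxx.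
  have /nbhs_ballP[e/= e0 eU] : nbhs x U by exact: open_nbhs_nbhs.
  have /ltr_add_invr[k] : 0 < e by [].
  rewrite add0r => ke; exists k => //=; apply: subset_trans eU.
  exact/le_ball/ltW.
Qed.

End inner_regularity.

(** * Compact inner approximation and Borel subsets of projections *)

Section observations.
Context {R : realType} (n : nat).

Definition cube (M : R) : set 'cV[R]_n := [set v | forall i, v i 0 \in `[- M, M]].

Lemma continuous_mxP (T : topologicalType) p q (f : T -> 'M[R]_(p, q)) :
  (forall i j, continuous (fun t => f t i j)) -> continuous f.
Proof.
move=> cf t A [P nP PA].
suff : \forall s \near t, forall i j, P i j (f s i j).
  by apply: filterS => s Ps; exact: PA.
apply: filter_forall => i; apply: filter_forall => j.
exact: (cf i j t _ (nP i j)).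
Qed.

(** Transposition turns the cube into a product of segments in the space of row vectors. *)
Lemma compact_cube M : compact (cube M).
Proof.
have -> : cube M = (fun v : 'rV[R]_n => v^T) @`
    [set v : 'rV[R]_n | forall i, v ord0 i \in `[- M, M]].
  apply/seteqP; split=> [v vM|_ [v vM <-] i]; last by rewrite mxE.
  by exists v^T; [move=> i; rewrite mxE; exact: vM|rewrite trmxK].
apply: continuous_compact.
  apply: continuous_subspaceT; apply: continuous_mxP => i j.
  rewrite (_ : (fun _ => _) = (fun v : 'rV[R]_n => v j i)); first exact: coord_continuous.
  by apply/funext => v; rewrite mxE.
apply: (@rV_compact _ _ (fun=> `[- M, M]%classic)) => _.
exact: segment_compact.
Qed.

Lemma cube_closed M : closed (cube M).
Proof. by apply: compact_closed; [exact: norm_hausdorff|exact: compact_cube]. Qed.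

Local Notation T := (obs R n).
Let p1 : T -> R := fun z => z.1.1.
Let p2 : T -> 'cV[R]_n := fun z => z.1.2.
Let p3 : T -> 'cV[R]_n := fun z => z.2.

Let fst_cont (U V : topologicalType) : continuous (@fst U V).
Proof. by move=> x; exact: cvg_fst. Qed.

Let snd_cont (U V : topologicalType) : continuous (@snd U V).
Proof. by move=> x; exact: cvg_snd. Qed.

Let p1_cont : continuous p1.
Proof. by move=> z; apply: continuous_comp; exact: fst_cont. Qed.

Let p2_cont : continuous p2.
Proof. by move=> z; apply: continuous_comp; [exact: fst_cont|exact: snd_cont]. Qed.

Let p3_cont : continuous p3. Proof. exact: snd_cont. Qed.

Let p1_meas : measurable_fun setT p1. Proof. exact: measurableT_comp. Qed.

Lemma measurable_obs_x : measurable_fun setT (@obs_x R n).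
Proof. exact: measurableT_comp. Qed.

Let p2_meas : measurable_fun setT p2. Proof. exact: measurable_obs_x. Qed.

Let p3_meas : measurable_fun setT p3. Proof. exact: measurable_snd. Qed.

(** Measurability is a separate clause because the sigma-algebra on observations is generated by the
    coordinates, not by the open sets of the product. *)
Let Kc : set (set T) := [set K : set T | [/\ compact K, closed K & measurable K]].

Let KcU : setU_closed Kc.
Proof.
move=> A B [? ? ?] [? ? ?]; split; [exact: compactU|exact: closedU|exact: measurableU].
Qed.

Let KcI (F : (set T)^nat) : (forall k, Kc (F k)) -> Kc (\bigcap_k F k).
Proof.
move=> KF; have cl : closed (\bigcap_k F k).
  by apply: closed_bigI => k _; have [] := KF k.
split => //; last by apply: bigcapT_measurable => k; have [] := KF k.
by have [c0 _ _] := KF 0%N; apply: subclosed_compact cl c0 _; exact: bigcap_inf.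
Qed.

Let K (k : nat) : set T := (`[- k%:R, k%:R]%classic `*` cube k%:R) `*` cube k%:R.

Let Kcpt k : compact (K k).
Proof.
apply: compact_setX; last exact: compact_cube.
by apply: compact_setX; [exact: segment_compact|exact: compact_cube].
Qed.

Let KE k : K k = p1 @^-1` `[- k%:R, k%:R]%classic `&` p2 @^-1` cube k%:R
  `&` p3 @^-1` cube k%:R.
Proof. by []. Qed.

Let KK k : Kc (K k).
Proof.
split => //; rewrite KE.
  apply: closedI; first apply: closedI.
  - by apply: (continuous_closedP _).1; [exact: p1_cont|exact: interval_closed].
  - by apply: (continuous_closedP _).1; [exact: p2_cont|exact: cube_closed].
  - by apply: (continuous_closedP _).1; [exact: p3_cont|exact: cube_closed].
have mc : measurable (cube k%:R) by apply: closed_measurable_mx; exact: cube_closed.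
apply: measurableI; first apply: measurableI.
- by rewrite -[X in measurable X]setTI; apply: p1_meas.
- by rewrite -[X in measurable X]setTI; apply: p2_meas.
- by rewrite -[X in measurable X]setTI; apply: p3_meas.
Qed.

Let KI (S : topologicalType) (f : T -> S) (D : set S) k :
  continuous f -> closed D -> measurable (f @^-1` D) -> Kc (K k `&` f @^-1` D).
Proof.
move=> cf cD mD; have [Kk1 Kk2 Kk3] := KK k.
have cl : closed (K k `&` f @^-1` D).
  by apply: closedI => //; exact: (continuous_closedP _).1 cf _ cD.
split => //; last exact: measurableI.
by apply: subclosed_compact cl Kk1 _; exact: subIsetl.
Qed.

Let le_in_itv (x : R) (i j : nat) : (i <= j)%N ->
  x \in `[- i%:R, i%:R] -> x \in `[- j%:R, j%:R].
Proof.
rewrite -(ler_nat R) !in_itv/= => ij /andP[? ?]; lra.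
Qed.

Let ndK : nondecreasing_seq K.
Proof.
move=> i j ij; apply/subsetPset => -[[a b] c] [[/= ha hb] hc]; split; first split => /=.
- exact: le_in_itv ha.
- by move=> l; exact: le_in_itv (hb l).
- by move=> l; exact: le_in_itv (hc l).
Qed.

Let cube_cover (v : 'cV[R]_n) : exists k : nat, cube k%:R v.
Proof.
exists (Num.Def.truncn `|v|).+1 => i; rewrite in_itv/= -ler_norml.
apply: (@le_trans _ _ `|v|); last exact/ltW/truncnS_gt.
rewrite [leRHS]mx_normrE.
by apply: (@le_bigmax _ _ _ 0 (fun ij => `|v ij.1 ij.2|) (i, 0)).
Qed.

Let KT : \bigcup_k K k = setT.
Proof.
apply/seteqP; split => // -[[a b] c] _.
have [j bj] := cube_cover b; have [k ck] := cube_cover c.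
pose i := (Num.Def.truncn `|a|).+1.
exists (maxn i (maxn j k)) => //; split; first split => /=.
- apply: (@le_in_itv _ i); first exact: leq_maxl.
  by rewrite in_itv/= -ler_norml; exact/ltW/truncnS_gt.
- move=> l; apply: le_in_itv (bj l).
  by rewrite (leq_trans (leq_maxl j k))// leq_maxr.
- move=> l; apply: le_in_itv (ck l).
  by rewrite (leq_trans (leq_maxr j k))// leq_maxr.
Qed.

Variable mu : probability T R.
Let appr := approximable mu Kc.
Let KcM : Kc `<=` measurable. Proof. by move=> ? []. Qed.
Let Kc0 : Kc set0.
Proof. by split; [exact: compact0|exact: closed0|exact: measurable0]. Qed.

Let appr_open (S : normedModType R) (f : T -> S) (U : set S) :
  continuous f -> (forall D, closed D -> measurable (f @^-1` D)) ->
  open U -> appr (f @^-1` U).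
Proof.
move=> cf mf oU; have [C [cC ndC UC]] := open_bigcup_closed oU.
apply: (@approximable_preimage _ _ _ mu Kc KcM K S f C U) => // D cD k.
by apply: KI => //; exact: mf.
Qed.

Let appr_sigma (S : Type) (f : T -> S) :
  sigma_algebra setT [set A : set S | appr (f @^-1` A)].
Proof.
split => /=.
- rewrite preimage_set0 -(@preimage_set0 _ _ p3).
  apply: appr_open => //.
  move=> D cD; rewrite -[X in measurable X]setTI.
  by apply: p3_meas => //; exact: closed_measurable_mx.
- by move=> A aA; rewrite setTD preimage_setC; exact: approximableC.
- move=> F aF; rewrite preimage_bigcup; exact: approximable_bigcup.
Qed.

(** The sets with approximable preimage form a sigma-algebra, by [appr_sigma], and they include the
    open sets of each factor. The argument follows the two nested products that generate the
    sigma-algebra on triples. *)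
Lemma measurable_approximable (A : set T) : measurable A -> approximable mu Kc A.
Proof.
have a1 (U : set R) : measurable U -> appr (p1 @^-1` U).
  have -> : (measurable : set (set R)) = <<s @RGenOpens.G R >>.
    exact: RGenOpens.measurableE.
  move: U; apply: smallest_sub; first exact: appr_sigma.
  move=> _ [x [y ->]] /=; apply: appr_open => //.
  move=> D cD; rewrite -[X in measurable X]setTI.
  by apply: p1_meas => //; exact: closed_measurable.
have a2 (U : set 'cV[R]_n) : measurable U -> appr (p2 @^-1` U).
  move: U; apply: smallest_sub; first exact: appr_sigma.
  move=> U oU /=; apply: appr_open => //.
  move=> D cD; rewrite -[X in measurable X]setTI.
  by apply: p2_meas => //; exact: closed_measurable_mx.
have a3 (U : set 'cV[R]_n) : measurable U -> appr (p3 @^-1` U).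
  move: U; apply: smallest_sub; first exact: appr_sigma.
  move=> U oU /=; apply: appr_open => //.
  move=> D cD; rewrite -[X in measurable X]setTI.
  by apply: p3_meas => //; exact: closed_measurable_mx.
have a12 (U : set (R * 'cV[R]_n)) : measurable U -> appr (fst @^-1` U).
  move: U; apply: smallest_sub; first exact: appr_sigma.
  move=> U [[V mV <-]|[V mV <-]]; rewrite setTI /=; [exact: a1|exact: a2].
move: A; apply: (@smallest_sub _ _ _ appr).
  exact: (appr_sigma id).
by move=> U [[V mV <-]|[V mV <-]]; rewrite setTI /=; [exact: a12|exact: a3].
Qed.

(* The image of a Borel set need not be Borel, hence the detour by compact
   subsets of [G]. *)
Lemma measurable_inner_projection (G : set T) : measurable G ->
  exists B : set 'cV[R]_n, [/\ measurable B, B `<=` (@obs_x R n) @` G &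
    mu (G `\` (@obs_x R n) @^-1` B) = 0%E].
Proof.
move=> mG; have aG := measurable_approximable mG.
have kp k : 0 < k.+1%:R^-1 :> R by rewrite invr_gt0.
have /choice[F FP] : forall k : nat, exists F, [/\ Kc F, F `<=` G &
    (mu (G `\` F) < (k.+1%:R^-1)%:E)%E].
  move=> k; have [F [H [KF KH FG HG muFH]]] := aG _ (kp k).
  exists F; split => //; apply: le_lt_trans muFH; apply: le_measure; rewrite ?inE.
  - by apply: measurableD => //; exact: KcM.
  - by apply: measurableC; apply: measurableU; exact: KcM.
  - by move=> z [Gz Fz] [//|/HG].
(* A continuous image of a compact set is compact, hence closed, hence Borel. *)
have mF k : measurable ((@obs_x R n) @` F k).
  have [[cF _ _] _ _] := FP k; apply: closed_measurable_mx.
  apply: compact_closed; first exact: norm_hausdorff.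
  by apply: continuous_compact => //; exact: continuous_subspaceT p2_cont.
pose B := \bigcup_k ((@obs_x R n) @` F k).
have mB : measurable B by apply: bigcupT_measurable.
exists B; split => //.
  move=> x [k _ [z Fz <-]]; exists z => //.
  by have [_ + _] := FP k; apply.
have mxB : measurable (@obs_x R n @^-1` B).
  by rewrite -[X in measurable X]setTI; exact: measurable_obs_x.
apply/eqP; rewrite -measure_le0; apply/lee_addgt0Pr => e e0; rewrite add0e.
have /ltr_add_invr[k] := e0; rewrite add0r => ke.
have [[_ _ mFk] _ muF] := FP k.
apply: (@le_trans _ _ (mu (G `\` F k))).
  apply: le_measure; rewrite ?inE; [exact: measurableD|exact: measurableD|].
  by move=> z [Gz Bz]; split => // Fz; apply: Bz; exists k => //; exists z.
by apply/ltW; apply: lt_trans muF _; rewrite lte_fin.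
Qed.

End observations.

(** * Conditional expectations given the covariate *)

Section conditional_expectation.
Context {R : realType}.
Local Open Scope ereal_scope.

Section nonmeasurable_integral.
Context d (T : measurableType d) (mu : {measure set T -> \bar R}).

Import HBNNSimple.

Let ge0_le_integral_off_null (D N : set T) (f g : T -> \bar R) :
  measurable N -> mu N = 0 -> (forall x, 0 <= f x) -> (forall x, 0 <= g x) ->
  (forall x, ~ N x -> f x = g x) ->
  \int[mu]_(x in D) f x <= \int[mu]_(x in D) g x.
Proof.
move=> mN N0 f0 g0 fg; rewrite !ge0_integralE//.
apply: ge_ereal_sup => _ [h /= hf <-].
have mNc : measurable (~` N) by exact: measurableC.
pose h' := mul_nnsfun h (indic_nnsfun R mNc).
have hE : sintegral mu h = sintegral mu h'.
  rewrite -!integralT_nnsfun; apply: ge0_ae_eq_integral => //.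
  - exact/measurable_EFinP.
  - exact/measurable_EFinP.
  - by move=> x _; rewrite lee_fin.
  - by move=> x _; rewrite lee_fin.
  - exists N; split => // x /= /not_implyP[_] H; apply: contrapT => Nx; apply: H.
    by rewrite mindicE mem_set// mulr1.
rewrite hE; apply: ereal_sup_ubound; exists h' => // x /=.
rewrite mindicE; have [xN|xN] := pselect (N x).
  rewrite memNset ?mulr0; last by move=> /(_ xN).
  by rewrite patchE; case: ifP => _; rewrite ?g0.
rewrite mem_set// mulr1; apply: le_trans (hf x) _; rewrite !patchE.
by case: ifP => // _; rewrite fg.
Qed.

Let ge0_integral_off_null (D N : set T) (f g : T -> \bar R) :
  measurable N -> mu N = 0 -> (forall x, 0 <= f x) -> (forall x, 0 <= g x) ->
  (forall x, ~ N x -> f x = g x) ->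
  \int[mu]_(x in D) f x = \int[mu]_(x in D) g x.
Proof.
move=> mN N0 f0 g0 fg; apply/eqP; rewrite eq_le.
by rewrite !(@ge0_le_integral_off_null _ N)// => x /fg.
Qed.

(* No measurability is assumed: the integral is a supremum over simple
   functions below the integrand, and these can be set to 0 on a null set. *)
Lemma integral_off_null (D : set T) (f g : T -> \bar R) :
  {ae mu, forall x, f x = g x} ->
  \int[mu]_(x in D) f x = \int[mu]_(x in D) g x.
Proof.
move=> [N [mN N0 fgN]].
have fg x : ~ N x -> f x = g x by move=> Nx; apply: contrapT => /fgN.
rewrite integralE [RHS]integralE; congr (_ - _).
  by apply: (@ge0_integral_off_null _ N) => // x Nx; rewrite !funeposE fg.
by apply: (@ge0_integral_off_null _ N) => // x Nx; rewrite !funenegE fg.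
Qed.

End nonmeasurable_integral.

Section uniqueness.
Variables (n : nat) (mu : probability (obs R n) R) (P : probability 'cV[R]_n R).
Hypothesis muP : forall B, measurable B -> mu (@obs_x R n @^-1` B) = P B.

Let mx_preim (B : set 'cV[R]_n) : measurable B -> measurable (@obs_x R n @^-1` B).
Proof. by move=> mB; rewrite -[X in measurable X]setTI; exact: measurable_obs_x. Qed.

(** [Q] is not assumed measurable, so its complement cannot be measured through [muP]. A Borel set
    [B] inside the projection of the complement of [N] is used instead: [Q] holds on [B], and the
    preimage of [B] has full measure. *)
Lemma ae_comp_obs_x (Q : set 'cV[R]_n) :
  {ae mu, forall z, Q (obs_x z)} -> {ae P, forall x, Q x}.
Proof.
move=> [N [mN N0 QN]].
have [B [mB BN muB]] := measurable_inner_projection mu (measurableC mN).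
exists (~` B); split; first exact: measurableC.
- rewrite -muP; last exact: measurableC.
  apply/eqP; rewrite -measure_le0.
  have := measureU2 mu mN (measurableD (measurableC mN) (mx_preim mB)).
  rewrite /= [X in _ <= X + _]N0 [X in _ <= _ + X]muB adde0; apply: le_trans.
  apply: le_measure; rewrite ?inE.
  + by apply: mx_preim; exact: measurableC.
  + apply: measurableU => //; apply: measurableD; [exact: measurableC|exact: mx_preim].
  + by move=> z Bz; have [Nz|Nz] := pselect (N z); [left|right].
- move=> x; apply: contra_not => Bx.
  by have [z Nz <-] := BN _ Bx; apply: contrapT => /QN.
Qed.

(** [phi] need not be measurable, so the set where it is positive cannot be a domain of integration.
    A Borel set [B] inside the projection of the set where [psi] is positive replaces it. *)
Let null_pos (phi : 'cV[R]_n -> R) (psi : obs R n -> \bar R) :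
  mu.-integrable setT psi -> {ae mu, forall z, (phi (obs_x z))%:E = psi z} ->
  (forall B, measurable B -> \int[mu]_(z in @obs_x R n @^-1` B) psi z = 0) ->
  {ae P, forall x, (phi x <= 0)%R}.
Proof.
move=> ipsi [N [mN N0 psiN]] int0; apply: ae_comp_obs_x.
have psiE z : ~ N z -> (phi (obs_x z))%:E = psi z.
  by move=> Nz; apply: contrapT => /psiN.
have mpsi := measurable_int _ ipsi.
pose G := [set z | 0 < psi z] `\` N.
have mG : measurable G.
  apply: measurableD => //; rewrite -[X in measurable X]setTI.
  exact: emeasurable_fun_o_infty.
have [B [mB BG muG]] := measurable_inner_projection mu mG.
have mxB := mx_preim mB.
have phiB x : B x -> (0 < phi x)%R.
  by move=> /BG[z [/= z0 Nz] <-]; rewrite -lte_fin psiE.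
have : mu (@obs_x R n @^-1` B) = 0.
  have mpsiB : measurable_fun (@obs_x R n @^-1` B) psi by exact: measurable_funTS.
  (* Over [B] the function [psi] equals [phi], hence is positive, off the null set [N]. Its
     vanishing integral is thus that of its absolute value, which forces the preimage of [B] to be
     null. *)
  have intabs : \int[mu]_(z in @obs_x R n @^-1` B) `|psi z| = 0.
    rewrite -[RHS](int0 B mB); apply: ae_eq_integral => //.
      exact: measurableT_comp.
    exists N; split => // z /= /not_implyP[Bz H]; apply: contrapT => Nz; apply: H.
    by rewrite -psiE// gee0_abs// lee_fin ltW// phiB.
  have /(ae_eq_integral_abs mu mxB mpsiB)[M [mM M0 psiM]] := intabs.
  apply/(negligibleP _ mxB); exists (M `|` N); split.
  - exact: measurableU.
  - by apply: (measure_negligible (measurableU _ _ mM mN)); apply: negligibleU; apply/negligibleP.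
  - move=> z Bz; have [Nz|Nz] := pselect (N z); [by right|left].
    apply: psiM => /= /(_ Bz); rewrite -psiE// => -[] phi0.
    by have := phiB _ Bz; rewrite phi0 ltxx.
move=> muB0.
exists (N `|` (G `\` @obs_x R n @^-1` B) `|` @obs_x R n @^-1` B); split.
- by apply: measurableU => //; apply: measurableU => //; exact: measurableD.
- have mD : measurable (G `\` @obs_x R n @^-1` B) by exact: measurableD.
  have := negligibleU (negligibleU ((negligibleP mu mN).2 N0) ((negligibleP mu mD).2 muG))
    ((negligibleP mu mxB).2 muB0).
  apply: measure_negligible.
  by apply: measurableU => //; exact: measurableU.
- move=> z /= /negP; rewrite -ltNge => phiz.
  have [Bz|Bz] := pselect (B (obs_x z)); [by right|left].
  have [Nz|Nz] := pselect (N z); [by left|right]; split => //; split => //=.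
  by rewrite -psiE.
Qed.

(** The residuals are replaced by integrable versions, whose difference has zero integral over every
    event determined by the covariate. [null_pos] is then applied to [phi] and to its opposite. *)
Lemma cond_expectation_unique (Z1 Z2 : obs R n -> R) (phi : 'cV[R]_n -> R) :
  is_cond_expectation mu Z1 (@obs_x R n) (cst 0%R) ->
  is_cond_expectation mu Z2 (@obs_x R n) (cst 0%R) ->
  (forall z, (Z1 z - Z2 z)%R = phi (obs_x z)) ->
  {ae P, forall x, phi x = 0%R}.
Proof.
move=> [[h1 ih1 Zh1] _ _ c1] [[h2 ih2 Zh2] _ _ c2] Zphi.
have zint (h : obs R n -> \bar R) (Z : obs R n -> R) :
    {ae mu, forall x, (EFin \o Z) x = h x} ->
    (forall B, measurable B -> \int[mu]_(z in @obs_x R n @^-1` B) (Z z)%:E =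
       \int[mu]_(z in @obs_x R n @^-1` B) (cst 0%R (obs_x z))%:E) ->
    forall B, measurable B -> \int[mu]_(z in @obs_x R n @^-1` B) h z = 0.
  by move=> Zh c B mB; rewrite -(integral_off_null _ Zh) c//= integral0_eq.
have hint (h h' : obs R n -> \bar R) (Z Z' : obs R n -> R) (f : 'cV[R]_n -> R) :
    mu.-integrable setT h -> mu.-integrable setT h' ->
    {ae mu, forall x, (EFin \o Z) x = h x} ->
    {ae mu, forall x, (EFin \o Z') x = h' x} ->
    (forall B, measurable B -> \int[mu]_(z in @obs_x R n @^-1` B) h z = 0) ->
    (forall B, measurable B -> \int[mu]_(z in @obs_x R n @^-1` B) h' z = 0) ->
    (forall z, (Z z - Z' z)%R = f (obs_x z)) ->
    {ae P, forall x, (f x <= 0)%R}.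
  move=> ih ih' Zh Zh' h0 h'0 Zf.
  apply: (@null_pos f (h \- h')).
  - exact: integrableB.
  - by apply: filterS2 Zh Zh' => z /= <- <-; rewrite -Zf.
  - move=> B mB; rewrite integralB; first by rewrite h0// h'0// subee.
    + exact: mx_preim.
    + by apply: integrableS ih => //; exact: mx_preim.
    + by apply: integrableS ih' => //; exact: mx_preim.
have le0 := hint _ _ _ _ phi ih1 ih2 Zh1 Zh2 (zint _ _ Zh1 c1) (zint _ _ Zh2 c2) Zphi.
have ge0 := hint _ _ _ _ (fun x => - phi x)%R ih2 ih1 Zh2 Zh1
  (zint _ _ Zh2 c2) (zint _ _ Zh1 c1) (fun z => etrans (esym (opprB _ _)) (congr1 -%R (Zphi z))).
apply: filterS2 le0 ge0 => x h1x h2x; apply/eqP; rewrite eq_le h1x/=; lra.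
Qed.

End uniqueness.

End conditional_expectation.

(** * Lebesgue null sets *)

Section lebesgue_null_sets.
Context {R : realType}.

(** The push-forward under a translation agrees with Lebesgue measure on half-open intervals, which
    determine it. *)
Lemma lebesgue_measure_shift (a : R) (A : set (measurableTypeR R)) : measurable A ->
  lebesgue_measure ((fun x => x + a) @^-1` A) = lebesgue_measure A.
Proof.
move=> mA.
have mshift : measurable_fun setT ((fun x => x + a) : measurableTypeR R -> measurableTypeR R).
  exact: measurable_funD.
transitivity (pushforward lebesgue_measure
  ((fun x => x + a) : measurableTypeR R -> measurableTypeR R) A) => //.
apply/esym/lebesgue_measure_unique => //= _ [[x y] _ <-].
rewrite /pushforward.
have -> : (fun z : R => z + a) @^-1` `]x, y] = `]x - a, y - a]%classic.
  by apply/seteqP; split=> z /=; rewrite !in_itv/= => /andP[? ?]; apply/andP; lra.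
rewrite !lebesgue_measure_itv/= !lte_fin ltrD2r.
by case: ifP => // _; rewrite -!EFinD; congr (_%:E); lra.
Qed.

(* Infinitely many translates of a bounded piece of [B] by rational numbers are
   pairwise disjoint and stay bounded. *)
Lemma lebesgue_null_rational_shift (B : set R) (e : R) :
  measurable B -> 0 < e ->
  (forall x, B x -> forall q : rat, 0 < (ratr q : R) < e -> ~ B (x + ratr q)) ->
  lebesgue_measure B = 0%E.
Proof.
move=> mB e0 Bq.
pose I (c : rat) : set R := `[ratr c - e / 4, ratr c + e / 4]%classic.
have BE : B = \bigcup_c (B `&` I c).
  apply/seteqP; split=> [x Bx|x [c _ []//]].
  have /rat_in_itvoo[c] : x - e / 4 < x + e / 4 by lra.
  rewrite in_itv/= => /andP[h1 h2]; exists c => //; split => //=.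
  by rewrite /I/= in_itv/=; apply/andP; lra.
have mBI c : measurable (B `&` I c).
  by apply: measurableI => //; exact: measurable_itv.
have mBU : measurable (\bigcup_c (B `&` I c)) by exact: bigcupT_measurable_rat.
rewrite BE; apply: (@measure_negligible _ (measurableTypeR R) R lebesgue_measure _ mBU).
(* Integers that code no rational are sent to 0, which only repeats a piece of the union. *)
pose f (k : nat) : rat := odflt 0 (unpickle k).
have -> : \bigcup_c (B `&` I c) = \bigcup_k (B `&` I (f k)).
  apply/seteqP; split=> [x [c _ Bc]|x [k _ Bk]]; last by exists (f k).
  by exists (pickle c) => //; rewrite /f pickleK.
apply: negligible_bigcup => k; apply/negligibleP; first exact: mBI.
set T := B `&` I (f k); have mT : measurable T by exact: mBI.
have [q0 q0e] : exists q : rat, 0 < (ratr q : R) < e / 2.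
  have /rat_in_itvoo[q] : 0 < e / 2 by lra.
  by rewrite in_itv/=; exists q.
(* A decreasing sequence in $]0, e/2[$: its differences lie in $]0, e[$, so the translates of [T]
   are disjoint. They also stay within $e/4 + e/2 < e$ of the centre of [I (f k)]. *)
pose q (j : nat) : rat := q0 / j.+1%:R.
have q0gt0 : 0 < q0 by move: q0e => /andP[]; rewrite ltr0q.
have qgt0 j : 0 < (ratr (q j) : R) by rewrite ltr0q divr_gt0.
have qlt j : (ratr (q j) : R) < e / 2.
  apply: (@le_lt_trans _ _ (ratr q0)); last by case/andP: q0e.
  by rewrite ler_rat ler_pdivrMr// ler_peMr ?ler1n// ltW.
have qdec i j : (i < j)%N -> 0 < (ratr (q i - q j) : R) < e.
  move=> ij; apply/andP; split.
    rewrite ltr0q subr_gt0 /q ltr_pM2l// ltf_pV2 ?posrE// ltr_nat//.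
  by rewrite rmorphB/=; have := qlt i; have := qgt0 j; lra.
pose F (j : nat) : set R := (fun x => x + (- ratr (q j))) @^-1` T.
have mF j : measurable (F j).
  have mf : measurable_fun setT (fun x : R => x + - ratr (q j)) by exact: measurable_funD.
  by rewrite -[X in measurable X]setTI; exact: mf.
have muF j : lebesgue_measure (F j) = lebesgue_measure T.
  exact: lebesgue_measure_shift.
have tF : trivIset setT F.
  apply: ltn_trivIset => j i ij; apply/seteqP; split=> // x [[Bi _] [Bj _]].
  apply: (Bq _ Bi (q i - q j)); first exact: qdec.
  by rewrite rmorphB/= addrA subrK.
have aux (x y z : R) : 0 < y -> y < e / 2 -> z - e / 4 <= x + - y ->
    x + - y <= z + e / 4 -> z - e <= x <= z + e.
  by move=> *; apply/andP; lra.
have bound N : (\sum_(i < N) lebesgue_measure T <= (e * 2)%:E)%E.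
  have -> : (\sum_(i < N) lebesgue_measure T = \sum_(i < N) lebesgue_measure (F i))%E.
    by apply: eq_bigr => i _; rewrite muF.
  rewrite -(@measure_bigsetU_ord _ _ _ lebesgue_measure N xpredT (fun i => F i))//; last first.
    by apply/trivIsetP => i j _ _ ij; move/trivIsetP : tF; apply.
    by move=> i; exact: mF.
  apply: (@le_trans _ _ (lebesgue_measure `[ratr (f k) - e, ratr (f k) + e]%classic)).
    apply: le_measure; rewrite ?inE.
    - by apply: bigsetU_measurable => i _; exact: mF.
    - exact: measurable_itv.
    - rewrite -bigcup_mkord => x [i _ [_]] /=; rewrite !in_itv/= => /andP[h1 h2].
      exact: (aux _ _ _ (qgt0 i) (qlt i)).
  rewrite lebesgue_measure_itv/=; case: ifP => _; last by rewrite lee_fin; lra.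
  by rewrite -EFinD lee_fin; lra.
have Tfin : lebesgue_measure T \is a fin_num.
  rewrite ge0_fin_numE//; have := bound 1%N; rewrite big_ord1 => /le_lt_trans; apply.
  exact: ltry.
apply/eqP; rewrite -measure_le0 leNgt; apply/negP => T0.
have r0 : 0 < fine (lebesgue_measure T) by rewrite fine_gt0// T0/= -ge0_fin_numE.
(* If [T] had positive measure, more than $2e/\lambda(T)$ disjoint translates would not fit in an
   interval of length $2e$. *)
have := truncnS_gt (e * 2 / fine (lebesgue_measure T)).
move: (Num.truncn _).+1 => N; rewrite ltNge ler_pdivlMr// => /negP; apply.
have := bound N; rewrite -[lebesgue_measure T]fineK// sumEFin lee_fin.
by rewrite sumr_const card_ord mulr_natl.
Qed.

End lebesgue_null_sets.

(** * Null sets of Lebesgue measure in several dimensions *)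

Section lebesgue_Rd_null_sets.
Context {R : realType}.

(** The identification of $\mathbb R\times\mathbb R^d$ with $\mathbb R^{1+d}$ used in the recursive
    clause of [lebesgue_Rd]. *)
Definition glue d (p : R * 'cV[R]_d) : 'cV[R]_(1 + d) := col_mx p.1%:M p.2.

Definition unglue d (v : 'cV[R]_(1 + d)) : R * 'cV[R]_d := (v 0 0, dsubmx v).

Lemma glueK d : cancel (@glue d) (@unglue d).
Proof.
move=> [a v]; rewrite /glue /unglue /= col_mxKd; congr (_, _).
by rewrite mxE; case: splitP => // j _; rewrite !mxE ord1 eqxx.
Qed.

Lemma measurable_glue d : measurable_fun setT (@glue d).
Proof.
apply: measurable_fun_mxP => i j; rewrite ord1.
rewrite (_ : (fun _ => _) = (fun p : R * 'cV[R]_d => match fintype.split i with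
    | inl _ => p.1 | inr k => p.2 k 0 end)); last first.
  by apply/funext => p; rewrite mxE; case: fintype.split => k //; rewrite !mxE ord1 eqxx.
case: fintype.split => k; first exact: measurable_fst.
exact: measurableT_comp (measurable_mx_coord _ _) measurable_snd.
Qed.

Lemma measurable_unglue d : measurable_fun setT (@unglue d).
Proof.
apply: measurable_fun_pair; first exact: measurable_mx_coord.
apply: measurable_fun_mxP => i j.
rewrite (_ : (fun _ => _) = fun v : 'cV[R]_(1 + d) => v (rshift 1 i) j).
  exact: measurable_mx_coord.
by apply/funext => v; rewrite mxE.
Qed.

Lemma glue_shift_head d (p : R * 'cV[R]_d) (t : R) :
  glue (p.1 + t, p.2) = glue p + t *: delta_mx (lshift d 0) 0.
Proof.
apply/colP => i; rewrite [RHS]mxE [X in _ = _ + X]mxE [X in _ = _ + _ * X]mxE /glue.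
case: (split_ordP i) => k ->.
  by rewrite !col_mxEu !ord1 !mxE !eqxx /= !mulr1n mulr1.
by rewrite !col_mxEd eq_rlshift/= mulr0 addr0.
Qed.

Lemma glue_shift_tail d (p : R * 'cV[R]_d) (t : R) (j : 'I_d) :
  glue (p.1, p.2 + t *: delta_mx j 0) = glue p + t *: delta_mx (rshift 1 j) 0.
Proof.
apply/colP => i; rewrite [RHS]mxE [X in _ = _ + X]mxE [X in _ = _ + _ * X]mxE /glue.
case: (split_ordP i) => k ->.
  by rewrite !col_mxEu eq_lrshift/= mulr0 addr0.
by rewrite !col_mxEd !mxE eq_rshift.
Qed.

Section extend.
Variables (d : nat) (m : {sigma_finite_measure set 'cV[R]_d -> \bar R}).
Local Open Scope ereal_scope.

Let ext : set 'cV[R]_(1 + d) -> \bar R := pushforward (@lebesgue_measure R \x m) (@glue d).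

Let mpre (A : set 'cV[R]_(1 + d)) : measurable A -> measurable (@glue d @^-1` A).
Proof. by move=> mA; rewrite -[X in measurable X]setTI; exact: measurable_glue. Qed.

Let ext0 : ext set0 = 0.
Proof. by rewrite /ext /pushforward preimage_set0 measure0. Qed.

Let ext_ge0 A : 0 <= ext A.
Proof. exact: (measure_ge0 (@lebesgue_measure R \x m)). Qed.

Let ext_sigma_additive : semi_sigma_additive ext.
Proof.
move=> F mF tF mUF; rewrite /ext /pushforward preimage_bigcup.
apply: measure_semi_sigma_additive.
- by move=> n; exact: mpre.
- apply/trivIsetP => /= i j _ _ ij; rewrite -preimage_setI.
  by move/trivIsetP : tF => /(_ _ _ _ _ ij) ->//; rewrite preimage_set0.
- by rewrite -preimage_bigcup; exact: mpre.
Qed.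

HB.instance Definition _ := isMeasure.Build _ _ _ ext ext0 ext_ge0 ext_sigma_additive.

Let ext_sigma_finite : sigma_finite setT ext.
Proof.
have /sigma_finiteP[F [FT ndF Foo]] := sigma_finiteT (@lebesgue_measure R).
have /sigma_finiteP[G [GT ndG Goo]] := sigma_finiteT m.
have glueC : @unglue d \o @glue d = id by apply/funext => p; exact: glueK.
exists (fun n => @unglue d @^-1` (F n `*` G n)).
  rewrite -preimage_bigcup (_ : \bigcup_n _ = setT) ?preimage_setT//.
  apply/seteqP; split => // -[x v] _.
  have [i _ Fx] : (\bigcup_n F n) x by rewrite -FT.
  have [j _ Gv] : (\bigcup_n G n) v by rewrite -GT.
  exists (maxn i j) => //; split => /=.
    by have /subsetPset := ndF _ _ (leq_maxl i j); apply.
  by have /subsetPset := ndG _ _ (leq_maxr i j); apply.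
move=> n; have [mF Fn] := Foo n; have [mG Gn] := Goo n; split.
  by rewrite -[X in measurable X]setTI; apply: measurable_unglue => //; exact: measurableX.
rewrite /ext /pushforward -comp_preimage glueC preimage_id product_measure1E//.
by rewrite lte_mul_pinfty// ge0_fin_numE.
Qed.

HB.instance Definition _ := Measure_isSigmaFinite.Build _ _ _ ext ext_sigma_finite.

Lemma extend_sigma_finite_measure :
  exists M : {sigma_finite_measure set 'cV[R]_(1 + d) -> \bar R},
    forall A, M A = (@lebesgue_measure R \x m) (@glue d @^-1` A).
Proof. by exists ext. Qed.

End extend.

(** [lebesgue_Rd] is defined as a bare set function. Its structure of sigma-finite measure, built by
    induction as a push-forward under [glue], allows the order of integration to be exchanged. *)
Lemma lebesgue_Rd_sigma_finite d :
  exists M : {sigma_finite_measure set 'cV[R]_d -> \bar R}, M = @lebesgue_Rd R d :> (_ -> _).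
Proof.
elim: d => [|d [M ME]]; first by exists (\d_(0 : 'cV[R]_0)).
have [M' M'E] := extend_sigma_finite_measure M.
by exists M'; apply/funext => A; rewrite M'E /= -ME.
Qed.

(** By induction on the dimension, every section of [B] containing the direction [i] inherits the
    no-return property and is null, so the product measure of [B] is an integral of zeros. *)
Lemma lebesgue_Rd_null_rational_shift d (i : 'I_d) (B : set 'cV[R]_d) (e : R) :
  measurable B -> 0 < e ->
  (forall x, B x -> forall q : rat, 0 < (ratr q : R) < e ->
    ~ B (x + ratr q *: delta_mx i 0)) ->
  lebesgue_Rd B = 0%E.
Proof.
elim: d i B => [[]//|d IH] i B mB e0 Bq.
have [m mE] := lebesgue_Rd_sigma_finite d.
have mB' : measurable (@glue d @^-1` B).
  by rewrite -[X in measurable X]setTI; exact: measurable_glue.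
have -> : lebesgue_Rd B = (@lebesgue_measure R \x m)%E (@glue d @^-1` B) by rewrite mE.
case: (split_ordP (i : 'I_(1 + d))) => j ij; last first.
  apply: integral0_eq => x _ /=; rewrite mE.
  apply: (IH j) => //; first exact: measurable_xsection.
  move=> v; rewrite /xsection/= inE => Bv q qe; rewrite inE /= => Bvq.
  apply: (Bq _ Bv _ qe); rewrite ij; rewrite -glue_shift_tail; exact: Bvq.
(* For the first coordinate the sections must be lines, so the product is computed in the other
   order. The two product measures agree on rectangles. *)
rewrite (@product_measure_unique _ _ _ _ _ _ m (@lebesgue_measure R \x^ m)%E) //; last first.
  by move=> A A' mA mA'; exact: product_measure2E.
apply: integral0_eq => v _ /=.
apply: (@lebesgue_null_rational_shift _ _ e) => //; first exact: measurable_ysection.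
move=> x; rewrite /ysection/= inE => Bx q qe; rewrite inE /= => Bxq.
apply: (Bq _ Bx _ qe); rewrite ij [j]ord1; rewrite -glue_shift_head; exact: Bxq.
Qed.

End lebesgue_Rd_null_sets.

(** * Differentiability of convex functions *)

Section convex_along_a_line.
Context {R : realType} (n : nat).
Implicit Types (f : 'cV[R]_n -> \bar R) (x v : 'cV[R]_n).

(** [fine] sends infinite values to 0, so the quotient is meaningful only where both values of [f]
    are finite. *)
Definition slope f x v (t : R) : R := (fine (f (x + t *: v)) - fine (f x)) / t.

Lemma econvex_fin f x y (t : R) : econvex f -> 0 <= t <= 1 ->
  f x \is a fin_num -> f y \is a fin_num ->
  f (t *: x + (1 - t) *: y) \is a fin_num /\
  fine (f (t *: x + (1 - t) *: y)) <= t * fine (f x) + (1 - t) * fine (f y).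
Proof.
move=> [fNy cf] t01 fx fy; have := cf x y t t01.
rewrite -{1}(fineK fx) -{1}(fineK fy) -!EFinM -EFinD.
move: (fNy (t *: x + (1 - t) *: y)); by case: (f _).
Qed.

(** The nearer point $x + sv$ is the convex combination of $x + tv$ and $x$ with weight $s/t$ on the
    former. *)
Lemma slope_fin f x v (s t : R) : econvex f -> 0 < s -> s <= t ->
  f x \is a fin_num -> f (x + t *: v) \is a fin_num ->
  f (x + s *: v) \is a fin_num /\ slope f x v s <= slope f x v t.
Proof.
move=> cf s0 st fx ft; have t0 : 0 < t by exact: lt_le_trans st.
have st01 : 0 <= s / t <= 1.
  apply/andP; split; first by rewrite divr_ge0// ltW.
  by rewrite ler_pdivrMr// mul1r.
have [] := econvex_fin cf st01 ft fx.
have -> : (s / t) *: (x + t *: v) + (1 - s / t) *: x = x + s *: v.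
  rewrite scalerDr scalerA divfK ?gt_eqF// scalerBl scale1r addrC addrA subrK//.
rewrite /slope => fs; move: (fine (f (x + t *: v))) (fine (f (x + s *: v))) (fine (f x)) => b c a H.
split => //; rewrite ler_pdivrMr//.
have -> : (b - a) / t * s = s / t * (b - a) by rewrite mulrC mulrA mulrAC.
lra.
Qed.

(** Here $x$ is the convex combination of $x + tv$ and $x - sv$ with weights $s/(s+t)$ and
    $t/(s+t)$. *)
Lemma slope_opp f x v (s t : R) : econvex f -> 0 < s -> 0 < t ->
  f (x - s *: v) \is a fin_num -> f (x + t *: v) \is a fin_num ->
  - slope f x (- v) s <= slope f x v t.
Proof.
move=> cf s0 t0 fs ft; have st0 : 0 < s + t by rewrite addr_gt0.
have st01 : 0 <= s / (s + t) <= 1.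
  apply/andP; split; first by rewrite divr_ge0// ltW.
  by rewrite ler_pdivrMr// mul1r lerDl ltW.
have [_] := econvex_fin cf st01 ft fs.
have e1 : 1 - s / (s + t) = t / (s + t) by field; rewrite gt_eqF.
have -> : (s / (s + t)) *: (x + t *: v) + (1 - s / (s + t)) *: (x - s *: v) = x.
  rewrite e1 !scalerDr scalerN !scalerA addrACA -scalerDl -mulrDl divff ?gt_eqF//.
  by rewrite scale1r mulrAC [s * t]mulrC [t / _ * s]mulrAC subrr addr0.
rewrite e1 /slope scalerN.
move: (fine (f (x + t *: v))) (fine (f (x - s *: v))) (fine (f x)) => b c a H.
have {}H : (s + t) * a <= s * b + t * c.
  have := ler_wpM2l (ltW st0) H.
  suff -> : (s + t) * (s / (s + t) * b + t / (s + t) * c) = s * b + t * c by [].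
  by field; rewrite gt_eqF.
rewrite -mulNr ler_pdivrMr// mulrAC ler_pdivlMr//; lra.
Qed.

(** The hypotheses say that [l] is the infimum of the forward slopes and [- l] that of the backward
    ones. Since slopes increase with the step, one good step on each side controls all smaller
    ones. *)
Lemma derivable_slope f x v (l : R) : econvex f -> f x \is a fin_num ->
  (forall t, 0 < t -> f (x + t *: v) \is a fin_num -> l <= slope f x v t) ->
  (forall t, 0 < t -> f (x - t *: v) \is a fin_num -> - l <= slope f x (- v) t) ->
  (forall e, 0 < e -> exists2 t, 0 < t & f (x + t *: v) \is a fin_num /\ slope f x v t < l + e) ->
  (forall e, 0 < e -> exists2 t, 0 < t & f (x - t *: v) \is a fin_num /\ slope f x (- v) t < - l + e) ->
  derivable (fun u => fine (f u) : R^o) x v.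
Proof.
move=> cf fx l1 l2 u1 u2.
apply/cvg_ex; exists l; apply/cvgrPdist_le => e e0.
have [t1 t10 [ft1 st1]] := u1 e e0; have [t2 t20 [ft2 st2]] := u2 e e0.
near=> h.
have h0 : h != 0 by near: h; exact: nbhs_dnbhs_neq.
have hm : `|h| < Num.min t1 t2.
  near: h; apply: dnbhs0_lt; by rewrite lt_min t10.
rewrite /= [h *: v + x]addrC.
rewrite lt_min in hm; case/andP: hm => hm1 hm2.
have [hn|hp|/eqP hE] := ltgtP h 0; last by rewrite hE in h0.
  (* A negative step along [v] is a positive step along [- v], with the opposite difference
     quotient. *)
  rewrite (ltr0_norm hn) in hm1 hm2.
  have [||fh sh] := @slope_fin f x (- v) (- h) t2 cf _ (ltW hm2) fx; rewrite ?oppr_gt0 ?scalerN//.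
  rewrite scalerN scaleNr opprK in fh.
  have := l2 (- h); rewrite oppr_gt0 hn scaleNr opprK => /(_ isT fh) l2h.
  have E : h^-1 *: (fine (f (x + h *: v)) - fine (f x)) = - slope f x (- v) (- h).
    by rewrite /slope scalerN scaleNr opprK invrN mulrN opprK /GRing.scale/= mulrC.
  rewrite [X in `|l - X|]E ler_norml; lra.
rewrite (gtr0_norm hp) in hm1 hm2.
have [fh sh] := slope_fin cf hp (ltW hm1) fx ft1.
have l1h := l1 h hp fh.
have E : h^-1 *: (fine (f (x + h *: v)) - fine (f x)) = slope f x v h.
  by rewrite /slope /GRing.scale/= mulrC.
rewrite [X in `|l - X|]E ler_norml; lra.
Unshelve. all: by end_near. Qed.

(* The second alternative holds for at most one point of each line in the
   direction [v], for given [r] and [r']. *)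
Lemma derivable_or_kink f x v (a b : R) : econvex f -> 0 < a -> 0 < b ->
  f x \is a fin_num -> f (x + a *: v) \is a fin_num ->
  f (x - b *: v) \is a fin_num ->
  derivable (fun u => fine (f u) : R^o) x v \/
  exists r r' : rat, [/\ r < r',
    forall t, 0 < t -> f (x + t *: v) \is a fin_num -> ratr r' <= slope f x v t &
    forall t, 0 < t -> f (x - t *: v) \is a fin_num -> - ratr r <= slope f x (- v) t].
Proof.
move=> cf a0 b0 fx fa fb.
pose U := [set slope f x v t | t in [set t | 0 < t /\ f (x + t *: v) \is a fin_num]].
pose V := [set slope f x (- v) t | t in [set t | 0 < t /\ f (x - t *: v) \is a fin_num]].
have U0 : U !=set0 by exists (slope f x v a), a.
have V0 : V !=set0 by exists (slope f x (- v) b), b.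
have UV u w : U u -> V w -> - w <= u.
  by move=> [t [t0 ft] <-] [s [s0 fs] <-]; exact: slope_opp.
have lU : has_lbound U by case: V0 => w Vw; exists (- w) => u Uu; exact: UV.
have lV : has_lbound V.
  by case: U0 => u Uu; exists (- u) => w Vw; rewrite lerNl; exact: UV.
have VU : - inf V <= inf U.
  apply: lb_le_inf => // u Uu; rewrite lerNl; apply: lb_le_inf => // w Vw.
  by rewrite lerNl; exact: UV.
have leU t : 0 < t -> f (x + t *: v) \is a fin_num -> inf U <= slope f x v t.
  by move=> t0 ft; apply: ge_inf => //; exists t.
have leV t : 0 < t -> f (x - t *: v) \is a fin_num -> inf V <= slope f x (- v) t.
  by move=> t0 ft; apply: ge_inf => //; exists t.
move: VU; rewrite le_eqVlt => /orP[/eqP VU|VU]; [left|right].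
  apply: (@derivable_slope _ _ _ (inf U)) => //.
  - by move=> t t0 ft; rewrite -VU opprK; exact: leV.
  - move=> e e0; have [_ [t [t0 ft] <-] te] := inf_adherent e0 (conj U0 lU).
    by exists t.
  - move=> e e0; have [_ [t [t0 ft] <-] te] := inf_adherent e0 (conj V0 lV).
    by exists t => //; rewrite -VU opprK.
(* A gap between the left and right derivatives leaves room for $-\inf V < r < r' < \inf U$. *)
have /rat_in_itvoo[r'] := VU; rewrite in_itv/= => /andP[Vr' r'U].
have /rat_in_itvoo[r] := Vr'; rewrite in_itv/= => /andP[Vr].
rewrite ltr_rat => rr'; exists r, r'; split => // t t0 ft.
  by apply: le_trans (leU t t0 ft); exact: ltW.
by apply: le_trans (leV t t0 ft); rewrite lerNl ltW.
Qed.

End convex_along_a_line.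

(** * Partial derivatives of convex functions almost everywhere *)

Section almost_everywhere_differentiability.
Context {R : realType} (n : nat) (P : probability 'cV[R]_n R).
Hypothesis Pac : P `<< @lebesgue_Rd R n.

Let e_ (i : 'I_n) : 'cV[R]_n := delta_mx i 0.

Lemma measurable_shift (v : 'cV[R]_n) : measurable_fun setT (fun x : 'cV[R]_n => x + v).
Proof.
apply: measurable_fun_mxP => i j.
rewrite (_ : (fun _ => _) = fun x : 'cV[R]_n => x i j + v i j).
  by apply: measurable_funD => //; exact: measurable_mx_coord.
by apply/funext => x; rewrite mxE.
Qed.

Lemma null_rational_shift (i : 'I_n) (B : set 'cV[R]_n) (e : R) :
  measurable B -> 0 < e ->
  (forall x, B x -> forall q : rat, 0 < (ratr q : R) < e ->
    ~ B (x + ratr q *: e_ i)) -> P B = 0%E.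
Proof.
(* Domination is checked on all measurable subsets of [B]; each inherits the no-return property. *)
move=> mB e0 Bq; apply: (Pac (t := B)) => //= A mA AB.
apply: (@lebesgue_Rd_null_rational_shift _ _ i A e) => // x Ax q qe /AB.
by apply: Bq => //; exact: AB.
Qed.

(** For fixed [k], the exceptional points form a Borel set [B] that no small positive rational shift
    maps into itself at any point, hence a null set. *)
Lemma ae_rational_recurrence (i : 'I_n) (D : set 'cV[R]_n) (neg : bool) : measurable D ->
  {ae P, forall x, D x -> forall k : nat, exists2 q : rat,
    0 < (ratr q : R) < k.+1%:R^-1 & D (x + ((-1) ^+ neg * ratr q) *: e_ i)}.
Proof.
move=> mD.
suff H k : {ae P, forall x, D x -> exists2 q : rat,
    0 < (ratr q : R) < k.+1%:R^-1 & D (x + ((-1) ^+ neg * ratr q) *: e_ i)}.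
  have := ae_foralln H; apply: filterS => x Hx Dx k; exact: Hx.
pose B := D `&` \bigcap_q [set x | 0 < (ratr q : R) < k.+1%:R^-1 ->
  ~ D (x + ((-1) ^+ neg * ratr q) *: e_ i)].
have mB : measurable B.
  apply: measurableI => //; rewrite -[X in measurable X]setCK setC_bigcap.
  apply: measurableC; apply: bigcupT_measurable_rat => q; apply: measurableC.
  have [qk|qk] := boolP (0 < (ratr q : R) < k.+1%:R^-1); last first.
    by rewrite (_ : mkset _ = setT)//; apply/seteqP; split.
  rewrite (_ : mkset _ = ~` ((fun x => x + ((-1) ^+ neg * ratr q) *: e_ i) @^-1` D)).
    by apply: measurableC; rewrite -[X in measurable X]setTI; exact: measurable_shift.
  by apply/seteqP; split => x /=; [apply|].
exists B; split => //; last first.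
  move=> x /= /not_implyP[Dx H]; split => // q _ qk Dq; apply: H; by exists q.
apply: (@null_rational_shift i _ k.+1%:R^-1) => // x [Dx Bx] q qk [Dq Bxq].
have {}Bx := Bx q I qk; have {}Bxq := Bxq q I qk.
(* For backward shifts the contradiction is read at $x + q e_i$, whose shift by $-q$ is $x$ itself;
   for forward shifts it is read at $x$. *)
case: {mB B} neg Bx Bxq => Bx Bxq.
  by apply: Bxq; rewrite expr1 mulN1r scaleNr addrK.
by apply: Bx; rewrite expr0 mul1r.
Qed.

Lemma ae_forall_countable (T : countType) (Q : T -> 'cV[R]_n -> Prop) :
  (forall t, {ae P, forall x, Q t x}) -> {ae P, forall x, forall t, Q t x}.
Proof.
move=> H; have : {ae P, forall x, forall k, if unpickle k is Some t then Q t x else True}.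
  by apply: ae_foralln => k; case: unpickle => [t|]; [exact: H|exact: aeW].
by apply: filterS => x Hx t; have := Hx (pickle t); rewrite pickleK.
Qed.

(** The points where [derivable_or_kink] gives a kink lie in countably many sets [N (r, r')]. These
    are Borel because they involve only the version [g], points of [D] and rational steps. *)
Lemma ae_derivable_coord (i : 'I_n) (f : 'cV[R]_n -> \bar R) (g : 'cV[R]_n -> R)
    (D : set 'cV[R]_n) : econvex f -> measurable_fun setT g -> measurable D ->
  {ae P, forall x, D x} -> (forall x, D x -> f x = (g x)%:E) ->
  {ae P, forall x, derivable (fun u => fine (f u) : R^o) x (e_ i)}.
Proof.
move=> cf mg mD PD fg.
have fD x : D x -> f x \is a fin_num by move=> /fg ->.
pose M (c s : R) := [set x | D (x + s *: e_ i) -> c <= g (x + s *: e_ i) - g x].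
have mM c s : measurable (M c s).
  have -> : M c s = ~` ((fun x => x + s *: e_ i) @^-1` D) `|`
      [set x | c <= g (x + s *: e_ i) - g x].
    apply/seteqP; split=> [x /= Mx|x /= [Dx|cx]]; [|by move=> /Dx|by []].
    by have [Dx|Dx] := pselect (D (x + s *: e_ i)); [right; exact: Mx|left].
  apply: measurableU.
    by apply: measurableC; rewrite -[X in measurable X]setTI; exact: measurable_shift.
  rewrite -[X in measurable X]setTI; apply: measurable_fun_ler => //.
  apply: measurable_funB => //.
  by apply: measurableT_comp => //; exact: measurable_shift.
pose N (p : rat * rat) := D `&` \bigcap_(q in [set q : rat | 0 < (ratr q : R)])
  (M (ratr p.2 * ratr q) (ratr q) `&` M (- ratr p.1 * ratr q) (- ratr q)).
have mN p : measurable (N p).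
  apply: measurableI => //; rewrite -[X in measurable X]setCK setC_bigcap bigcup_mkcond.
  apply: measurableC; apply: bigcupT_measurable_rat => q; case: ifP => // _.
  by apply: measurableC; exact: measurableI.
have N0 (p : rat * rat) : p.1 < p.2 -> P (N p) = 0%E.
  (* If $x$ and $x + q e_i$ were both in [N (r, r')], then $r'q \le g(x + q e_i) - g(x) \le rq$,
     against $r < r'$. *)
  move=> p12; apply: (@null_rational_shift i _ 1) => // x [Dx Nx] q /andP[q0 _] [Dq Nq].
  have [H1 _] := Nx q q0; have [_ H2] := Nq q q0.
  have := H1 Dq; have := H2; rewrite /M/= scaleNr addrK => /(_ Dx) h2 h1.
  have : (ratr p.2 - ratr p.1) * ratr q <= 0 :> R by rewrite mulrBl; lra.
  by rewrite leNgt mulr_gt0// subr_gt0 ltr_rat.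
have aeN : {ae P, forall x, forall p : rat * rat, p.1 < p.2 -> ~ N p x}.
  apply: ae_forall_countable => p.
  have [p12|p12] := boolP (p.1 < p.2); last exact: aeW.
  by exists (N p); split; [exact: mN|exact: N0|move=> x /= /not_implyP[_ /contrapT]].
have rp := ae_rational_recurrence i false mD.
have rn := ae_rational_recurrence i true mD.
near=> x.
have Dx : D x by near: x.
have xN : forall p : rat * rat, p.1 < p.2 -> ~ N p x by near: x.
(* Recurrence supplies points of [D] on both sides of [x], where [f] is finite. *)
have [qp /andP[qp0 _] Dp] : exists2 q : rat, 0 < (ratr q : R) < 1%:R^-1 &
    D (x + ((-1) ^+ false * ratr q) *: e_ i) by move: Dx; near: x; apply: filterS rp => y + Dy; apply.
have [qn /andP[qn0 _] Dn] : exists2 q : rat, 0 < (ratr q : R) < 1%:R^-1 &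
    D (x + ((-1) ^+ true * ratr q) *: e_ i) by move: Dx; near: x; apply: filterS rn => y + Dy; apply.
rewrite expr0 mul1r in Dp; rewrite expr1 mulN1r scaleNr in Dn.
have [//|[r [r' [rr' h1 h2]]]] :=
  derivable_or_kink cf qp0 qn0 (fD _ Dx) (fD _ Dp) (fD _ Dn).
exfalso; apply: (xN (r, r')) => //; split=> // q /= q0; split => Dq.
  have := h1 _ q0 (fD _ Dq).
  by rewrite /slope (fg _ Dq) (fg _ Dx)/= ler_pdivlMr.
rewrite scaleNr in Dq *; have := h2 _ q0 (fD _ Dq).
by rewrite /slope scalerN (fg _ Dq) (fg _ Dx)/= ler_pdivlMr.
Unshelve. all: by end_near. Qed.

(** Once both derivatives exist, they may be computed along any one sequence of nonzero steps
    tending to 0. *)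
Lemma derive_eq_recurrence (F G : 'cV[R]_n -> R^o) (x v : 'cV[R]_n) (l : R) :
  derivable F x v -> derivable G x v ->
  (forall k : nat, exists2 t : R, 0 < t < k.+1%:R^-1 &
    F (x + t *: v) - F x = G (x + t *: v) - G x + t * l) ->
  'D_v F x = 'D_v G x + l.
Proof.
move=> dF dG H.
have /choice[t tP] : forall k : nat, exists t : R, 0 < t < k.+1%:R^-1 /\
    F (x + t *: v) - F x = G (x + t *: v) - G x + t * l.
  by move=> k; have [t t1 t2] := H k; exists t.
have t0 k : t k != 0 by have [/andP[/gt_eqF ->]] := tP k.
have ct : t k @[k --> \oo] --> (0 : R)^'.
  move=> A; rewrite /dnbhs/= => -[e /= e0 eA].
  suff : \forall k \near \oo, A (t k) by [].
  near=> k; apply: eA => //=.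
  rewrite sub0r normrN; have [/andP[h1 h2] _] := tP k; rewrite gtr0_norm//.
  apply: lt_trans h2 _; near: k; exact: (near_infty_natSinv_lt (PosNum e0)).
have cF : (t k)^-1 *: (F (t k *: v + x) - F x) @[k --> \oo] --> 'D_v F x.
  exact: cvg_comp ct dF.
have cG : (t k)^-1 *: (G (t k *: v + x) - G x) @[k --> \oo] --> 'D_v G x.
  exact: cvg_comp ct dG.
have E : (fun k => (t k)^-1 *: (F (t k *: v + x) - F x)) =
    (fun k => (t k)^-1 *: (G (t k *: v + x) - G x) + l).
  apply/funext => k; rewrite ![t k *: v + x]addrC; have [_ ->] := tP k.
  by rewrite scalerDr; congr (_ + _); rewrite /GRing.scale/= mulrA mulVf// mul1r.
have cGl : (t k)^-1 *: (F (t k *: v + x) - F x) @[k --> \oo] --> 'D_v G x + l.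
  by rewrite E; exact: cvgD cG (cvg_cst l).
by rewrite -(cvg_lim (@Rhausdorff R) cF) -(cvg_lim (@Rhausdorff R) cGl).
Unshelve. all: by end_near. Qed.

(** Off a null set the two functions differ by an affine function. Almost every point has
    arbitrarily small rational steps that stay off this set, and these suffice to compare partial
    derivatives. *)
Lemma gradient_ae_eq (f1 f2 : 'cV[R]_n -> \bar R) (g : 'cV[R]_n -> R)
    (c : 'cV[R]_n) (k : R) :
  econvex f1 -> econvex f2 -> measurable_fun setT g ->
  {ae P, forall x, f2 x = (g x)%:E} ->
  {ae P, forall x, f1 x = (g x + dot x c + k)%:E} ->
  {ae P, forall x, gradient f1 x = gradient f2 x + c}.
Proof.
move=> cf1 cf2 mg f2g f1g.
have [N [mN N0 NS]] := filterI f2g f1g.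
pose D := ~` N; have mD : measurable D by exact: measurableC.
have aeD : {ae P, forall x, D x}.
  by exists N; split=> // x; rewrite /D/= => /contrapT.
have f2D x : D x -> f2 x = (g x)%:E by move=> Dx; apply: contrapT => h; apply: Dx; apply: NS => -[].
have f1D x : D x -> f1 x = (g x + dot x c + k)%:E.
  by move=> Dx; apply: contrapT => h; apply: Dx; apply: NS => -[].
have dotE x : dot x c = \sum_i x i 0 * c i 0.
  by rewrite /dot mxE; apply: eq_bigr => i _; rewrite mxE.
have mdot : measurable_fun setT (fun x : 'cV[R]_n => dot x c).
  rewrite (_ : (fun _ => _) = fun x : 'cV[R]_n => \sum_i x i 0 * c i 0); last exact/funext.
  apply: measurable_sum => i; apply: measurable_funM => //; exact: measurable_mx_coord.
have mg1 : measurable_fun setT (fun x => g x + dot x c + k).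
  by apply: measurable_funD => //; exact: measurable_funD.
have d1 : {ae P, forall x, forall i, derivable (fun u => fine (f1 u) : R^o) x (e_ i)}.
  by apply: ae_forall_countable => i; exact: (ae_derivable_coord i cf1 mg1 mD aeD f1D).
have d2 : {ae P, forall x, forall i, derivable (fun u => fine (f2 u) : R^o) x (e_ i)}.
  by apply: ae_forall_countable => i; exact: (ae_derivable_coord i cf2 mg mD aeD f2D).
have rp : {ae P, forall x, forall i : 'I_n, D x -> forall k : nat, exists2 q : rat,
    0 < (ratr q : R) < k.+1%:R^-1 & D (x + ((-1) ^+ false * ratr q) *: e_ i)}.
  by apply: ae_forall_countable => i; exact: ae_rational_recurrence.
near=> x.
have Dx : D x by near: x.
have d1x : forall i, derivable (fun u => fine (f1 u) : R^o) x (e_ i) by near: x.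
have d2x : forall i, derivable (fun u => fine (f2 u) : R^o) x (e_ i) by near: x.
have rpx : forall i : 'I_n, D x -> forall k : nat, exists2 q : rat,
    0 < (ratr q : R) < k.+1%:R^-1 & D (x + ((-1) ^+ false * ratr q) *: e_ i) by near: x.
apply/colP => i; rewrite !mxE.
apply: (derive_eq_recurrence (d1x i) (d2x i)) => m; have [q q0 Dq] := rpx i Dx m.
rewrite expr0 mul1r in Dq; exists (ratr q) => //.
rewrite (f1D _ Dq) (f1D _ Dx) (f2D _ Dq) (f2D _ Dx)/=.
have -> : dot (x + ratr q *: e_ i) c = dot x c + ratr q * c i 0.
  rewrite !dotE (bigD1 i)//= [in RHS](bigD1 i)//= !mxE !eqxx/= mulr1.
  rewrite mulrDl -!addrA; congr (_ + _); rewrite addrC; congr (_ + _).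
  by apply: eq_bigr => j /negPf ji; rewrite !mxE ji/= mulr0 addr0.
lra.
Unshelve. all: by end_near. Qed.

End almost_everywhere_differentiability.

(** * Identification *)

Section support.
Context {R : realType} (n : nat).

Lemma continuous_mulmx (M : 'M[R]_n) : continuous (fun y : 'cV[R]_n => M *m y).
Proof.
apply: continuous_mxP => i j.
have -> : (fun y : 'cV[R]_n => (M *m y) i j) = \sum_k (fun y : 'cV[R]_n => M i k * y k j).
  by apply/funext => y; rewrite mxE fct_sumE.
apply: (big_ind (fun f : 'cV[R]_n -> R => continuous f)) => [y|f g cf cg y|k _ y].
- exact: (@cst_continuous _ _ (0 : R)).
- exact: cvgD (cf y) (cg y).
- exact: (cvgM (cvg_cst (M i k)) (@coord_continuous R n 1 k j y)).
Qed.

Lemma msupport_closed_sub (Q : probability 'cV[R]_n R) (L : set 'cV[R]_n) :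
  closed L -> Q (~` L) = 0%E -> msupport Q `<=` L.
Proof.
move=> cL QL y Qy; apply: contrapT => Ly.
by have := Qy _ (closed_openC cL) Ly; rewrite QL ltxx.
Qed.

(** By dimension, [n] free vectors span the whole space, so [M] kills every basis column. *)
Lemma free_mulmx_eq0 (X : n.-tuple 'cV[R]_n) (M : 'M[R]_n) :
  free X -> (forall i : 'I_n, M *m X`_i = 0) -> M = 0.
Proof.
move=> fX MX.
have sX : <<X>>%VS = fullv.
  apply/eqP; rewrite eqEdim subvf/= dimvf /dim/= muln1.
  by move: fX; rewrite /free size_tuple => /eqP ->.
have Mv (v : 'cV[R]_n) : M *m v = 0.
  have /coord_span -> : v \in <<X>>%VS by rewrite sX memvf.
  rewrite mulmx_sumr big1// => i _; rewrite -scalemxAr MX scaler0//.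
apply/matrixP => i j.
have := Mv (delta_mx j 0); rewrite -colE => /colP /(_ i).
by rewrite !mxE.
Qed.

End support.

Lemma econvexD_cst (R : realType) (n : nat) (w : 'cV[R]_n -> \bar R) (c : R) :
  econvex w -> econvex (fun x => w x + c%:E)%E.
Proof.
move=> [wNy cw]; split => [x|x y t t01].
  by have := wNy x; case: (w x).
have := cw x y t t01; have := wNy x; have := wNy y.
have /andP[t0 t1] := t01.
have E : c%:E = (t%:E * c%:E + (1 - t)%:E * c%:E)%E.
  by rewrite -!EFinM -EFinD -mulrDl addrC subrK mul1r.
move=> _ _ H.
rewrite !muleDr// ?fin_num_adde_defl// addeACA -E.
exact: leeD2r.
Qed.

Theorem theorem1 (R : realType) (d : nat)
  (X Y : set 'cV[R]_d) (P Q : probability 'cV[R]_d R)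
  (hX : {ae P, forall x, X x}) (hY : Y = msupport Q)
  (A0 : 'M[R]_d) (b0 : 'cV[R]_d) (c0 : R) (w0o : 'cV[R]_d -> \bar R)
  (Theta : set 'cV[R]_(d * d + d)) (mu : probability (obs R d) R)
  (hP2 : finite_second_moment P) (hQ2 : finite_second_moment Q)
  (hPac : P `<< @lebesgue_Rd R d)
  (hA0 : A0 \in unitmx)
  (hY3 : exists y : 'I_d.+1 -> 'cV[R]_d, (forall i, Y (y i)) /\
     free [tuple y (widen_ord (leqnSn d) i) - y (lift ord0 i) | i < d])
  (hconv : econvex w0o)
  (hdual : dual_solution P Q X A0 w0o)
  (hassign : pushes_forward P (assignment A0 w0o) Q)
  (hTheta : compact Theta) (hTheta0 : Theta (theta_of A0 b0))
  (hmuP : forall B, measurable B -> mu (@obs_x R d @^-1` B) = P B)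
  (hmoment : moment_restriction mu (theta_of A0 b0)
               (fun x => w0o x + c0%:E)%E) :
  identified mu P Theta (theta_of A0 b0) (fun x => w0o x + c0%:E)%E.
Proof.
move=> A b w uA _ cw wfin hm.
set w0 := fun x => (w0o x + c0%:E)%E in hmoment *.
have thbE A' (b' : 'cV[R]_d) : theta_b (theta_of A' b') = b'.
  by rewrite /theta_b /theta_of col_mxKd.
have thAE A' (b' : 'cV[R]_d) : theta_invA (theta_of A' b') = invmx A'.
  by rewrite /theta_invA /theta_of col_mxKu trmxK mxvecK trmxK.
have dotD (x u v : 'cV[R]_d) : dot x (u - v) = dot x u - dot x v.
  by rewrite /dot mulmxBr !mxE.
(* Integrability in the dual problem provides a real-valued Borel version of [w0o]. *)
have [g mg w0og] : exists2 g : 'cV[R]_d -> R, measurable_fun setT g &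
    {ae P, forall x, w0o x = (g x)%:E}.
  have [[g ig w0og] _] := hdual.
  exists (fine \o g).
    by apply: measurableT_comp => //; exact: measurable_int ig.
  have := integrable_ae measurableT ig.
  by apply: filterS2 w0og => x -> /(_ I) gx /=; rewrite fineK.
have wg : {ae P, forall x, w x = (g x + dot x (b0 - b) + c0)%:E}.
  have i0 : {ae P, forall x, fine (w0 x) + dot x b0 - (fine (w x) + dot x b) = 0}.
    apply: (cond_expectation_unique hmuP (hm (lshift d 0)) (hmoment (lshift d 0))).
    (* The observed wage cancels between the two residuals, leaving a function of [x] alone. *)
    move=> [[wage x] y]; rewrite /rho !col_mxEu !mxE !thbE /obs_x /= !mulr1n; lra.
  near=> x.
  have gx : w0o x = (g x)%:E by near: x.
  have wx : w x \is a fin_num by near: x.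
  have ix : fine (w0 x) + dot x b0 - (fine (w x) + dot x b) = 0 by near: x.
  rewrite -(fineK wx); congr (_%:E); move: ix; rewrite /w0 gx dotD /=; lra.
have w0g : {ae P, forall x, w0 x = (g x + dot x 0 + c0)%:E}.
  apply: filterS w0og => x gx; rewrite /w0 gx.
  by rewrite /dot mulmx0 mxE addr0.
have gw := gradient_ae_eq hPac cw hconv mg w0og wg.
have gw0 := gradient_ae_eq hPac (econvexD_cst c0 hconv) hconv mg w0og w0g.
have mom (i : 'I_d) : {ae P, forall x, (invmx A0 *m gradient w0 x) i 0 -
    (invmx A *m gradient w x) i 0 = 0}.
  apply: (cond_expectation_unique hmuP (hm (rshift 1 i)) (hmoment (rshift 1 i))).
  move=> [[wage x] y]; rewrite /rho !col_mxEd /= !thAE /obs_x /=.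
  by move: (invmx A *m _) (invmx A0 *m _) => u v; rewrite !mxE; lra.
have [h [mh hE hQ]] := hassign.
(* The equation $A^{-1}(A_0 y + b_0 - b) = y$ in affine form. Its solution set is closed, so it
   contains the support of [Q] as soon as it has full measure. *)
pose L := [set y : 'cV[R]_d | (invmx A *m A0 - 1%:M) *m y = - (invmx A *m (b0 - b))].
have cL : closed L.
  have cont := @continuous_mulmx R d (invmx A *m A0 - 1%:M).
  apply: ((continuous_closedP _).1 cont [set - (invmx A *m (b0 - b))]).
  apply: accessible_closed_set1; apply: hausdorff_accessible; exact: norm_hausdorff.
have QL : Q (~` L) = 0%E.
  have mL : measurable (~` L) by apply: measurableC; exact: closed_measurable_mx.
  rewrite -hQ//; apply: measure_negligible.
    by rewrite -[X in measurable X]setTI; exact: mh.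
  have mom' := ae_forall_countable mom.
  suff : {ae P, forall x, L (h x)} by [].
  near=> x.
  have hx : assignment A0 w0o x = h x by near: x.
  have gx : gradient w x = gradient w0o x + (b0 - b) by near: x.
  have g0x : gradient w0 x = gradient w0o x + 0 by near: x.
  have momx : forall i, (invmx A0 *m gradient w0 x) i 0 -
    (invmx A *m gradient w x) i 0 = 0 by near: x.
  have : invmx A0 *m gradient w0 x = invmx A *m gradient w x.
    by apply/colP => i; apply/eqP; rewrite -subr_eq0; apply/eqP.
  rewrite gx g0x addr0 -/(assignment A0 w0o x) hx => hxE.
  have A0h : A0 *m h x = gradient w0o x by rewrite -hx /assignment mulKVmx.
  by rewrite /L/= mulmxBl mul1mx -mulmxA A0h hxE mulmxDr opprD addrA subrr add0r.
have YL : Y `<=` L by rewrite hY; exact: msupport_closed_sub.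
(* Differences of points of [L] lie in the kernel of this matrix, and [d] of them are
   independent. *)
have M0 : invmx A *m A0 - 1%:M = 0.
  have [y [Yy fy]] := hY3; apply: free_mulmx_eq0 fy _ => i.
  rewrite -tnth_nth tnth_mktuple mulmxBr.
  by rewrite (YL _ (Yy _)) (YL _ (Yy _)) subrr.
have AA0 : A = A0.
  move/eqP : M0; rewrite subr_eq0 => /eqP /(congr1 (mulmx A)).
  by rewrite mulKVmx// mulmx1.
(* With the linear part gone, a single point of the support makes the constant term vanish. *)
have bb0 : b0 - b = 0.
  have [y [Yy _]] := hY3; have := YL _ (Yy ord0).
  rewrite /L/= M0 mul0mx => /esym/eqP; rewrite oppr_eq0 => /eqP /(congr1 (mulmx A)).
  by rewrite mulKVmx// mulmx0.
split; first by rewrite AA0; congr theta_of; apply/eqP; rewrite eq_sym -subr_eq0 bb0.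
by apply: filterS2 wg w0g => x wx w0x; rewrite wx bb0 -w0x.
Unshelve. all: by end_near. Qed.
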